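(* Let $C$ be a pure normal simplicial complex, $S$ a nonempty set of vertices of $C$, and $\Gamma=[F_0,\dots,F_N]$ a dual path in $C$ in which $F_N$ is the only facet intersecting $S$. Then $\Gamma$ is a combinatorial segment from $F_0$ to $S$ (anchored at some vertex $x_0\in F_0$) if and only if the facets of $\Gamma$ can be given vertex orderings for which $\Gamma$ is monotone and conservative towards $S$.
   Context: All simplicial complexes are finite. A complex is pure of dimension $d-1$ (a $(d-1)$-complex) if all its facets (inclusion-maximal faces) have $d$ elements. Two facets are adjacent if they differ in a single vertex; this defines the dual graph. A dual path is a path $[F_0,\dots,F_N]$ in the dual graph, and its length is $N$. A pure complex is normal if between every two facets $F,F'$ there is a dual path consisting only of facets containing $F\cap F'$. The link of a vertex $v$ is $\mathrm{lk}_C(v)=\{f\in C: v\notin f,\ f\cup\{v\}\in C\}$. Vertex-distance. $\mathrm{vdist}_C(u,v)$ is the graph distance in the 1-skeleton of $C$, and $\mathrm{vdist}_C(S,S')=\min_{u\in S,v\in S'}\mathrm{vdist}_C(u,v)$, equal to $\infty$ if $S$ or $S'$ is empty. If $\dim C=0$, then for nonempty $S,S'$ one sets $\mathrm{vdist}_C(S,S')=0$ if $S\cap S'\neq\emptyset$ and $1$ otherwise. Vector of distances. Let $F=(v_1,\dots,v_d)$ be an ordered facet (a facet with an ordering of its vertices) of a pure $(d-1)$-complex $C$ and $S$ a set of vertices of $C$ (target set). The vector of distances $(\lambda_1,\dots,\lambda_d)$ from $F$ to $S$ is defined recursively: $\lambda_1=\mathrm{vdist}_C(v_1,S)$, and $(\lambda_2,\dots,\lambda_d)$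 is the vector of distances from $F\setminus v_1$ (with induced order) to $S'$ in $\mathrm{lk}_C(v_1)$, where, with $V_1$ the vertex set of $\mathrm{lk}_C(v_1)$, $S'=\{v\in V_1:\mathrm{vdist}_C(v,S)=\mathrm{vdist}_C(v_1,S)-1\}$ if $v_1\notin S$, and $S'=S\cap V_1$ if $v_1\in S$. (If the target set is empty at some stage, all entries from there on are $\infty$.) The ordering is admissible with respect to $S$ if $\lambda_1=\mathrm{vdist}_C(F,S)$ and $F\setminus v_1$ is admissible with respect to $S'$ in $\mathrm{lk}_C(v_1)$ (the empty ordered facet is admissible). Monotone and conservative. Let $C$ be pure and normal, $S$ a nonempty target set, and $[F_0,\dots,F_N]$ a dual path of ordered facets. It is monotone towards $S$ if the vectors of distances of $F_0,\dots,F_N$ to $S$ are strictly lexicographically decreasing. The index of a step from $F_{i-1}=(v_1,\dots,v_d)$ to $F_i=(v_1',\dots,v_d')$ is the minimum $k$ with $v_k\neq v_k'$. The step is conservative towards $S$ if (i) the vertex in $F_{i-1}\setminus F_i$ is the last vertex in the ordering of $F_{i-1}$, and (ii) the ordering of $F_i$ is admissible with respect to $S$ and has the maximum index among all admissible reorderings of $F_i$. The path is conservative towards $S$ if $F_0$ is admissible with respect to $S$ and every step is conservative. Combinatorial segments. A dual path $\Gamma=[F_0,\dots,F_N]$ (of unordered facets) with $x_0\in F_0$ in a pure $(d-1)$-complex $C$ is a combinatorial segment from the facet $F_0$ to the set $S$ anchored at $x_0$ if, recursively: 1) if $F_0\cap S\neq\emptyset$, then $N=0$; 2) if $d=1$ and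 $F_0\cap S=\emptyset$, then $N=1$ and $\Gamma=[\{x_0\},\{v\}]$ with $v\in S$; 3) if $d>1$ and $F_0\cap S=\emptyset$, then: (a) $F_N$ is the unique facet of $\Gamma$ intersecting $S$; (b) letting $\ell=\mathrm{vdist}_C(F_0,S)$, $k=\min\{i\in\{1,\dots,N\}:\mathrm{vdist}_C(F_i,S)<\ell\}$, and $y$ the unique vertex of $F_k$ with $\mathrm{vdist}_C(y,S)=\ell-1$, one has $x_0\in F_0\cap\dots\cap F_k$, and the path $\Gamma_1'=[F_0\setminus x_0,\dots,F_k\setminus x_0]$ is a combinatorial segment in $\mathrm{lk}_C(x_0)$ (anchored at some vertex) from $F_0\setminus x_0$ to the set of neighbors of $x_0$ at vertex-distance $\ell-1$ from $S$ in $C$; (c) the path $[F_k,\dots,F_N]$ is a combinatorial segment from $F_k$ to $S$ anchored at $y$. *)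

(* Defs.v *)
From HB Require Import structures.
From mathcomp Require Import all_boot all_order.

Set Implicit Arguments.
Unset Strict Implicit.
Unset Printing Implicit Defensive.

Import Order.TTheory.
Local Open Scope order_scope.

(** * Extended natural numbers: [Some n] is [n] and [None] is infinity *)

Definition natoo := option nat.
HB.instance Definition _ := Choice.on natoo.

Definition natoo_le (a b : natoo) : bool :=
  match a, b with
  | _, None => true
  | None, Some _ => false
  | Some m, Some n => (m <= n)%N
  end.

Fact natoo_le_refl : reflexive natoo_le.
Proof. by case=> [n|] /=. Qed.

Fact natoo_le_anti : antisymmetric natoo_le.
Proof. by case=> [m|] [n|] //= /anti_leq ->. Qed.

Fact natoo_le_trans : transitive natoo_le.
Proof. by case=> [n|] [m|] [p|] //=; apply: leq_trans. Qed.

Fact natoo_le_total : total natoo_le.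
Proof. by case=> [m|] [n|] //=; apply: leq_total. Qed.

Fact natoo_display : Order.disp_t. Proof. exact: Order.Disp tt tt. Qed.

HB.instance Definition _ := Order.Le_isPOrder.Build natoo_display natoo
  natoo_le_refl natoo_le_anti natoo_le_trans.
HB.instance Definition _ :=
  Order.POrder_isTotal.Build natoo_display natoo natoo_le_total.

Lemma natoo_leE (a b : natoo) : (a <= b) = natoo_le a b.
Proof. by []. Qed.

Lemma natoo_ltE (m n : nat) : ((Some m : natoo) < Some n) = (m < n)%N.
Proof. by rewrite lt_def natoo_leE /= ltn_neqAle eq_sym. Qed.

(** * Simplicial complexes *)

(* The ambient type V may contain elements that are not vertices of C; this is
   needed to view links as complexes over the same type. *)
Definition simplicial_complex (V : finType) (C : {set {set V}}) : Prop :=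
  set0 \in C /\ forall f g : {set V}, f \in C -> g \subset f -> g \in C.

Definition vertices (V : finType) (C : {set {set V}}) : {set V} :=
  [set v | [set v] \in C].

Definition facets (V : finType) (C : {set {set V}}) : {set {set V}} :=
  [set F | maxset (mem C) F].

(* One more than the dimension. *)
Definition rank (V : finType) (C : {set {set V}}) : nat :=
  (\max_(f in C) #|f|)%N.

(* Pure of dimension d - 1. *)
Definition pure (V : finType) (d : nat) (C : {set {set V}}) : Prop :=
  forall F, F \in facets C -> #|F| = d.

Definition link (V : finType) (C : {set {set V}}) (v : V) : {set {set V}} :=
  [set f in C | (v \notin f) && (v |: f \in C)].

Definition adjacent (V : finType) (F G : {set V}) : bool :=
  (#|F :\: G| == 1%N) && (#|G :\: F| == 1%N).

Definition dual_path (V : finType) (C : {set {set V}}) (P : seq {set V}) :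
  bool := all (mem (facets C)) P && sorted (@adjacent V) P.

Definition normal (V : finType) (C : {set {set V}}) : Prop :=
  forall F F', F \in facets C -> F' \in facets C ->
  exists P : seq {set V},
    [/\ dual_path C (F :: P), last F P = F'
      & {in F :: P, forall G : {set V}, F :&: F' \subset G}].

(** * Vertex-distance *)

Definition skel (V : finType) (C : {set {set V}}) : rel V :=
  fun u v => (u != v) && ([set u; v] \in C).

Definition walk (V : finType) (e : rel V) (u v : V) (n : nat) : bool :=
  [exists p : n.-tuple V, path e u p && (last u p == v)].

(* Searching below #|V| suffices: a shortest walk does not repeat vertices. *)
Definition gdist (V : finType) (e : rel V) (u v : V) : natoo :=
  let k := find (walk e u v) (iota 0 #|V|) in
  if (k < #|V|)%N then Some k else None.

Lemma walkP (V : finType) (e : rel V) (u v : V) (n : nat) :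
  reflect (exists p, [/\ path e u p, last u p = v & size p = n])
          (walk e u v n).
Proof.
apply: (iffP existsP) => [[p /andP[ep /eqP lp]]|[p [ep lp sp]]].
  by exists p; rewrite size_tuple.
by move/eqP: sp => sp; exists (Tuple sp); rewrite /= ep lp eqxx.
Qed.

Lemma gdist_SomeP (V : finType) (e : rel V) (u v : V) (n : nat) :
  gdist e u v = Some n <->
  walk e u v n /\ (forall m, (m < n)%N -> ~~ walk e u v m).
Proof.
rewrite /gdist; set k := find _ _; split.
  case: ifP => // kV [<-]; split.
    have hk : has (walk e u v) (iota 0 #|V|) by rewrite has_find size_iota.
    by have := nth_find 0%N hk; rewrite nth_iota.
  move=> m mk; have := before_find 0%N mk.
  by rewrite nth_iota ?(ltn_trans mk) // => ->.
case=> wn ltn_n.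
have nV : (n < #|V|)%N.
  have /walkP[p [ep lp sp]] := wn.
  case/shortenP: ep lp => p' ep' up' _ lp.
  have sz : (size p' < #|V|)%N.
    by rewrite -[(size p').+1]/(size (u :: p')) -(card_uniqP up') max_card.
  apply: leq_ltn_trans sz; rewrite leqNgt; apply/negP => /ltn_n /negP; apply.
  by apply/walkP; exists p'.
suff -> : k = n by rewrite nV.
apply/eqP; rewrite eqn_leq; apply/andP; split; rewrite leqNgt; apply/negP => h.
  by have := before_find 0%N h; rewrite nth_iota // wn.
have kV : (k < #|V|)%N := ltn_trans h nV.
have hk : has (walk e u v) (iota 0 #|V|) by rewrite has_find size_iota.
have := nth_find 0%N hk; rewrite nth_iota // add0n => wk.
by have := ltn_n _ h; rewrite wk.
Qed.

Lemma gdist_NoneP (V : finType) (e : rel V) (u v : V) :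
  gdist e u v = None <-> ~~ connect e u v.
Proof.
split=> [gN|].
  apply/negP => /connectP[p ep lp].
  have ex : exists n, walk e u v n by exists (size p); apply/walkP; exists p.
  have /gdist_SomeP : walk e u v (ex_minn ex) /\
      (forall m, (m < ex_minn ex)%N -> ~~ walk e u v m).
    case: ex_minnP => n wn nmin; split=> // m mn; apply/negP => /nmin.
    by rewrite leqNgt mn.
  by rewrite gN.
case gE: gdist => [n|//]; have [/walkP[p [ep lp _]] _] := (gdist_SomeP _ _ _ _).1 gE.
by move/negP; case; apply/connectP; exists p.
Qed.

Definition vdist (V : finType) (C : {set {set V}}) (S T : {set V}) : natoo :=
  if rank C == 1%N then
    if (S == set0) || (T == set0) then None
    else if S :&: T != set0 then Some 0%N else Some 1%N
  else \big[@Order.min _ natoo/None]_(u in S)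
         \big[@Order.min _ natoo/None]_(v in T) gdist (skel C) u v.

(** * Ordered facets, vectors of distances, admissible orderings *)

Definition orders (V : finType) (s : seq V) (F : {set V}) : bool :=
  uniq s && ([set x in s] == F).

(* When v is not in S and S is empty, vdist is infinite, so the next target is
   empty as well and all remaining distances are infinite. *)
Definition next_target (V : finType) (C : {set {set V}}) (S : {set V}) (v : V) :
  {set V} :=
  if v \in S then S :&: vertices (link C v)
  else [set w in vertices (link C v) |
         if vdist C [set v] S is Some l.+1 then vdist C [set w] S == Some l
         else false].

Fixpoint dist_vector (V : finType) (C : {set {set V}}) (S : {set V})
    (s : seq V) : seq natoo :=
  if s is v :: s' then
    vdist C [set v] S :: dist_vector (link C v) (next_target C S v) s'
  else [::].

Fixpoint admissible (V : finType) (C : {set {set V}}) (S : {set V})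
    (s : seq V) : bool :=
  if s is v :: s' then
    (vdist C [set v] S == vdist C [set x in s] S) &&
    admissible (link C v) (next_target C S v) s'
  else true.

(** * Monotone and conservative paths of ordered facets *)

Definition monotone (V : finType) (C : {set {set V}}) (S : {set V})
    (G : seq (seq V)) : bool :=
  sorted (fun a b : seqlexi natoo => b < a) (map (dist_vector C S) G).

Definition step_index (V : finType) (s t : seq V) : nat :=
  (find (fun p : V * V => p.1 != p.2) (zip s t)).+1.

Definition conservative_step (V : finType) (C : {set {set V}}) (S : {set V})
    (s t : seq V) : bool :=
  [&& if s is x :: s' then [set z in s] :\: [set z in t] == [set last x s']
      else false,
      admissible C S t
    & all (fun t' => admissible C S t' ==>
                     (step_index s t' <= step_index s t)%N)
          (permutations t)].

Definition conservative (V : finType) (C : {set {set V}}) (S : {set V})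
    (G : seq (seq V)) : bool :=
  if G is s :: G' then admissible C S s && path (conservative_step C S) s G'
  else false.

(** * Combinatorial segments *)

Definition only_last_meets (V : finType) (S F0 : {set V}) (P : seq {set V}) :
  bool := [set F in F0 :: P | F :&: S != set0] == [set last F0 P].

(* Anchored at the third argument. In the third constructor ell = l.+1: since F0
   is disjoint from S and the path reaches S, ell is positive and finite. The
   split at Fk encodes k = min {i : vdist C (F_i) S < ell}. *)
Inductive comb_segment (V : finType) :
  {set {set V}} -> {set V} -> V -> seq {set V} -> Prop :=
| comb_segment_meet C S x0 F0 of
    F0 \in facets C & x0 \in F0 & F0 :&: S != set0 :
    comb_segment C S x0 [:: F0]
| comb_segment_dim0 C S x0 v of
    rank C = 1%N & dual_path C [:: [set x0]; [set v]] &
    [set x0] :&: S = set0 & v \in S :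
    comb_segment C S x0 [:: [set x0]; [set v]]
| comb_segment_rec C S x0 F0 P1 Fk P2 l y x1 of
    (1 < rank C)%N & dual_path C (F0 :: P1 ++ Fk :: P2) &
    F0 :&: S = set0 &
    only_last_meets S F0 (P1 ++ Fk :: P2) &
    vdist C F0 S = Some l.+1 &
    {in P1, forall F, ~~ (vdist C F S < Some l.+1)} &
    vdist C Fk S < Some l.+1 &
    [set z in Fk | vdist C [set z] S == Some l] = [set y] &
    {in F0 :: rcons P1 Fk, forall F : {set V}, x0 \in F} &
    comb_segment (link C x0)
      [set w | skel C x0 w && (vdist C [set w] S == Some l)]
      x1 [seq F :\ x0 | F : {set V} <- F0 :: rcons P1 Fk] &
    comb_segment C S y (Fk :: P2) :
    comb_segment C S x0 (F0 :: P1 ++ Fk :: P2).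

(* Main.v *)
(* As long as the distance to S stays equal to l, the first vertex x of a
   monotone conservative path is kept, because the index of each step is
   maximal, and deleting x gives a monotone conservative path in the link of
   x towards the neighbors of x at distance l - 1; when the distance drops,
   the new facet contains a unique vertex y at distance l - 1, every
   admissible ordering of it starts with y, and y is the next anchor. These
   are exactly the two halves of the recursive definition of a combinatorial
   segment. The two descriptions differ at the facet where the distance
   drops: seen from the link of x it must be ordered so as to have maximal
   index there, seen from C it starts with y and any admissible ordering
   will do, since the index is 1. *)

Require Import Defs.
From mathcomp Require Import all_boot all_order.

Set Implicit Arguments.
Unset Strict Implicit.
Unset Printing Implicit Defensive.

Import Order.TTheory.
Local Open Scope order_scope.

Section ExtendedNaturals.
Implicit Types (a b : natoo) (m n : nat).

Lemma natoo_le_None a : a <= None.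
Proof. by rewrite natoo_leE; case: a. Qed.

Lemma natoo_le0x a : (Some 0%N : natoo) <= a.
Proof. by rewrite natoo_leE; case: a. Qed.

Lemma natoo_lt_Some a n : a < Some n -> exists2 m, a = Some m & (m < n)%N.
Proof.
case: a => [m|]; first by rewrite natoo_ltE => mn; exists m.
by rewrite ltNge natoo_le_None.
Qed.

End ExtendedNaturals.

Section VertexDistance.
Variable V : finType.
Implicit Types (C : {set {set V}}) (F S : {set V}) (u v x : V).

Lemma walk0 (e : rel V) u v : walk e u v 0 = (u == v).
Proof.
apply/walkP/eqP => [[p [_ lp /size0nil p0]]|->]; last by exists [::].
by rewrite -lp p0.
Qed.

Lemma gdist_eq0 (e : rel V) u v : (gdist e u v == Some 0%N) = (u == v).
Proof.
by rewrite -(walk0 e); apply/eqP/idP => [/gdist_SomeP[]|w] //;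
  apply/gdist_SomeP.
Qed.

Lemma gdist_walk (e : rel V) u v n : walk e u v n -> gdist e u v <= Some n.
Proof.
move=> w; case: leP => //.
case g: (gdist e u v) => [m|] nm.
  rewrite natoo_ltE in nm; have [_ /(_ _ nm)] := (gdist_SomeP _ _ _ _).1 g.
  by rewrite w.
have /walkP[p [ep lp _]] := w.
by move: ((gdist_NoneP _ _ _).1 g) => /negP; case; apply/connectP; exists p.
Qed.

Lemma vdist_set1 C S u : rank C != 1%N ->
  vdist C [set u] S = \big[@Order.min _ natoo/None]_(v in S) gdist (skel C) u v.
Proof.
by move=> /negPf rC; rewrite /vdist rC (@bigmin_set1 _ natoo);
  apply/min_l/natoo_le_None.
Qed.

Lemma vdist_set1_rank1 C S u : rank C = 1%N ->
  vdist C [set u] S =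
  if S == set0 then None else if u \in S then Some 0%N else Some 1%N.
Proof.
move=> rC; rewrite /vdist rC eqxx; have /negPf-> : [set u] != set0.
  by apply/set0Pn; exists u; apply: set11.
by rewrite /= setI_eq0 disjoints1 negbK.
Qed.

Lemma vdist_bigmin C F S :
  vdist C F S = \big[@Order.min _ natoo/None]_(u in F) vdist C [set u] S.
Proof.
have [rC|rC] := eqVneq (rank C) 1%N; last first.
  by under eq_bigr do rewrite vdist_set1 //; rewrite /vdist (negPf rC).
under eq_bigr do rewrite (vdist_set1_rank1 _ _ rC).
rewrite /vdist rC eqxx.
have [->|[x xF]] := set_0Vmem F; first by rewrite eqxx big_set0.
have /negPf-> : F != set0 by apply/set0Pn; exists x.
rewrite /=; case: ifP => _.
  by rewrite big_const; elim: #|_| => //= n <-.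
case: ifP => [/set0Pn[y]|/negbFE/eqP FS].
  rewrite inE => /andP[yF yS]; apply/esym/le_anti; rewrite natoo_le0x andbT.
  by apply: bigmin_inf yF _; rewrite yS.
rewrite (eq_bigr (fun=> Some 1%N)) => [|y yF]; last first.
  by case: ifP => // yS; have := in_set0 y; rewrite -FS inE yF yS.
apply/esym/le_anti/andP; split; first exact: bigmin_inf xF _.
by apply/bigmin_geP; split.
Qed.

Lemma vdist_le_set1 C F S x : x \in F -> vdist C F S <= vdist C [set x] S.
Proof. by move=> xF; rewrite vdist_bigmin; apply: bigmin_inf xF _. Qed.

Lemma vdist_attained C F S : F != set0 ->
  exists2 x, x \in F & vdist C [set x] S = vdist C F S.
Proof.
case/set0Pn => x xF; rewrite (vdist_bigmin C F).
have [|y yF ->] := @eq_bigmin _ natoo _ None x (mem F)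
  (fun u => vdist C [set u] S) xF; last by exists y.
by move=> *; apply: natoo_le_None.
Qed.

Lemma vdist1_eq0 C S x : (vdist C [set x] S == Some 0%N) = (x \in S).
Proof.
have [rC|rC] := eqVneq (rank C) 1%N; last first.
  rewrite vdist_set1 //; apply/eqP/idP => [S0|xS]; last first.
    apply/le_anti; rewrite natoo_le0x andbT; apply: bigmin_inf xS _.
    by have /eqP-> : gdist (skel C) x x == Some 0%N by rewrite gdist_eq0.
  have [S00|[y yS]] := set_0Vmem S; first by rewrite S00 big_set0 in S0.
  have [|z zS zE] := @eq_bigmin _ natoo _ None y (mem S) (gdist (skel C) x) yS.
    by move=> *; apply: natoo_le_None.
  by rewrite zE in S0; have /eqP-> : x == z by rewrite -(gdist_eq0 (skel C)) S0.
by rewrite vdist_set1_rank1 //; case: (eqVneq S set0) => [->|_];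
  [rewrite in_set0|case: ifP].
Qed.

Lemma vdist_eq0 C F S : (vdist C F S == Some 0%N) = (F :&: S != set0).
Proof.
apply/eqP/set0Pn => [F0|[x]]; last first.
  rewrite inE -(vdist1_eq0 C S) => /andP[xF /eqP x0]; apply/le_anti.
  by rewrite natoo_le0x andbT -x0 vdist_le_set1.
have [Fe|F1] := eqVneq F set0; first by rewrite Fe vdist_bigmin big_set0 in F0.
have [x xF xE] := vdist_attained C S F1.
by exists x; rewrite inE xF -(vdist1_eq0 C S) xE F0 eqxx.
Qed.

Lemma vdist_rank1 C F S : rank C = 1%N -> F != set0 -> S != set0 ->
  F :&: S = set0 -> vdist C F S = Some 1%N.
Proof. by move=> rC F0 S0 FS;
  rewrite /vdist rC !eqxx (negPf F0) (negPf S0) FS eqxx. Qed.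

Lemma vdist_skel C S u v n : rank C != 1%N -> skel C u v ->
  vdist C [set v] S = Some n -> vdist C [set u] S <= Some n.+1.
Proof.
move=> rC uv; rewrite !vdist_set1 // => vn.
have [S0|[y yS]] := set_0Vmem S; first by rewrite S0 big_set0 in vn.
have [|z zS zE] := @eq_bigmin _ natoo _ None y (mem S) (gdist (skel C) v) yS.
  by move=> *; apply: natoo_le_None.
rewrite zE in vn; have [/walkP[p [ep lp sp]] _] := (gdist_SomeP _ _ _ _).1 vn.
apply: bigmin_inf zS _; apply: gdist_walk; apply/walkP.
by exists (v :: p); rewrite /= uv ep lp sp.
Qed.

End VertexDistance.

Section Links.
Variable V : finType.
Implicit Types (C : {set {set V}}) (F S : {set V}) (u v x : V).

Lemma link_complex C x : simplicial_complex C -> [set x] \in C ->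
  simplicial_complex (link C x).
Proof.
move=> [_ subC] xC; split=> [|f g].
  by rewrite !inE setU0 xC (subC _ _ xC) ?sub0set.
rewrite !inE => /and3P[fC xf xfC] gf; apply/and3P; split.
- exact: subC gf.
- by apply: contra xf; apply: (subsetP gf).
- by apply: subC xfC _; apply: setUS.
Qed.

Lemma facetP C F :
  reflect (F \in C /\ forall G,
    G \in C -> F \subset G -> G = F) (F \in facets C).
Proof. by rewrite inE; apply: maxsetP. Qed.

Lemma facet_sub C f : f \in C -> exists2 F, F \in facets C & f \subset F.
Proof.
move=> fC; have [F maxF fF] := @maxset_exists _ (mem C) f fC.
by exists F; rewrite ?inE.
Qed.

Lemma link_facet C x F : simplicial_complex C -> F \in facets C -> x \in F ->
  F :\ x \in facets (link C x).
Proof.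
move=> [_ subC] /facetP[FC maxF] xF; apply/facetP; split=> [|g].
  by rewrite !inE eqxx setD1K // FC (subC _ _ FC) // subD1set.
rewrite !inE => /and3P[_ xg xgC] Fg.
have <- : x |: g = F by apply: maxF => //; rewrite -(setD1K xF) setUS.
by rewrite setU1K.
Qed.

Lemma link_pure C x d : simplicial_complex C -> pure d.+1 C ->
  pure d (link C x).
Proof.
move=> [_ subC] pC F /facetP[]; rewrite !inE => /and3P[FC xF xFC] maxF.
suff /pC : x |: F \in facets C by rewrite cardsU1 xF => -[].
apply/facetP; split=> // G GC xFG.
have xG : x \in G by apply: (subsetP xFG); rewrite setU11.
rewrite -(setD1K xG); congr (_ |: _); apply: maxF.
  by rewrite !inE eqxx setD1K // GC (subC _ _ GC) // subD1set.
by rewrite subsetD1 xF (subset_trans _ xFG) // subsetUr.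
Qed.

Lemma pure_rank C d : simplicial_complex C -> pure d C -> rank C = d.
Proof.
move=> [C0 _] pC; apply/eqP; rewrite eqn_leq; apply/andP; split.
  apply/bigmax_leqP => f /facet_sub[F /pC <-]; exact: subset_leq_card.
have [F FC _] := facet_sub C0; rewrite -(pC F FC).
by have /facetP[FinC _] := FC; apply: leq_bigmax_cond.
Qed.

Lemma skel_facet C F x y : simplicial_complex C -> F \in facets C ->
  x \in F -> y \in F -> x != y -> skel C x y.
Proof.
move=> [_ subC] /facetP[FC _] xF yF xy; rewrite /skel xy (subC _ _ FC) //.
by apply/subsetP => z; rewrite !inE => /orP[]/eqP->.
Qed.

Lemma next_targetE C S x l : simplicial_complex C ->
  vdist C [set x] S = Some l.+1 ->
  next_target C S x = [set w | skel C x w && (vdist C [set w] S == Some l)].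
Proof.
move=> [_ subC] xl; have xS : x \notin S by rewrite -(vdist1_eq0 C) xl.
rewrite /next_target (negPf xS) xl; apply/setP => w; rewrite !inE /skel.
congr (_ && _); apply/and3P/andP => [[] //|[xw xwC]]; split=> //.
by apply: subC xwC _; apply: subsetUr.
Qed.

End Links.

Section Orderings.
Variable V : finType.
Implicit Types (C : {set {set V}}) (F S : {set V}) (x y : V) (s t : seq V).

Lemma ordersP s F : reflect (uniq s /\ [set z in s] = F) (orders s F).
Proof. by apply: (iffP andP) => -[us /eqP]. Qed.

Lemma orders_cons x s F :
  orders (x :: s) F = (x \in F) && orders s (F :\ x).
Proof.
apply/ordersP/andP => [[/= /andP[xs us] <-]|[xF /ordersP[us sF]]].
  by rewrite /orders us set_cons setU1K ?inE ?xs ?eqxx //= !inE eqxx.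
have xs : x \notin s by move/setP/(_ x): sF; rewrite !inE eqxx /= => ->.
by rewrite set_cons /= us xs sF setD1K.
Qed.

Lemma orders_perm s t F : orders s F -> perm_eq t s -> orders t F.
Proof.
move=> /ordersP[us <-] ts; apply/ordersP; rewrite (perm_uniq ts); split=> //.
by apply/setP => z; rewrite !inE (perm_mem ts).
Qed.

Lemma orders_perm_eq s t F : orders s F -> orders t F -> perm_eq s t.
Proof.
move=> /ordersP[us sF] /ordersP[ut tF]; apply: uniq_perm => // z.
by move/setP/(_ z): sF; rewrite -tF !inE.
Qed.

Lemma admissible_exists C S F : exists2 s, orders s F & admissible C S s.
Proof.
move: {2}#|F| (erefl #|F|) => n; elim: n C S F => [|n IHn] C S F.
  by move/cards0_eq->; exists [::] => //; apply/ordersP; split.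
move=> Fn; have F0 : F != set0 by rewrite -cards_eq0 Fn.
have [x xF xE] := vdist_attained C S F0.
have [|s sF adm] := IHn (link C x) (next_target C S x) (F :\ x).
  by move: Fn; rewrite (cardsD1 x) xF => -[].
have xsF : orders (x :: s) F by rewrite orders_cons xF.
by exists (x :: s) => //; have [_ /= ->] := ordersP _ _ xsF; rewrite xE eqxx.
Qed.

Lemma admissible_cons C S x s F : orders (x :: s) F ->
  admissible C S (x :: s) =
  (vdist C [set x] S == vdist C F S) &&
  admissible (link C x) (next_target C S x) s.
Proof. by case/ordersP => _ <-. Qed.

Lemma admissible_exists_cons C S F x :
  x \in F -> vdist C [set x] S = vdist C F S ->
  exists2 s, orders (x :: s) F & admissible C S (x :: s).
Proof.
move=> xF xE.
have [s sF adm] := admissible_exists (link C x) (next_target C S x) (F :\ x).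
have xsF : orders (x :: s) F by rewrite orders_cons xF.
by exists s => //; rewrite (admissible_cons _ _ xsF) xE eqxx.
Qed.

Definition monotone_conservative_step C S s t : bool :=
  ((dist_vector C S t : seqlexi natoo) < dist_vector C S s) &&
  conservative_step C S s t.

Lemma monotone_conservativeE C S s (G : seq (seq V)) :
  monotone C S (s :: G) && conservative C S (s :: G) =
  admissible C S s && path (monotone_conservative_step C S) s G.
Proof.
rewrite /monotone /conservative /= path_map andbCA; congr (_ && _).
by rewrite -path_relI; apply: eq_path.
Qed.

Lemma step_index_cons x y s t : step_index (x :: s) (y :: t) =
  if x == y then (step_index s t).+1 else 1%N.
Proof. by rewrite /step_index /=; case: eqP. Qed.

Lemma step_cons C S x s t F :
  uniq (x :: s) -> orders (x :: t) F ->
  vdist C [set x] S = vdist C F S ->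
  monotone_conservative_step C S (x :: s) (x :: t) =
  monotone_conservative_step (link C x) (next_target C S x) s t.
Proof.
move=> /= /andP[xs us] xtF xE; have := xtF; rewrite orders_cons => /andP[xF tF].
rewrite /monotone_conservative_step /conservative_step ltxi_cons lexx /=.
rewrite -/(admissible C S (x :: t)) (admissible_cons _ _ xtF) xE eqxx /=.
congr (_ && [&& _, _ & _]).
  have -> : [set z in x :: s] :\: [set z in x :: t] =
      [set z in s] :\: [set z in t].
    apply/setP => z; rewrite !inE; case: eqP => //= ->.
    by rewrite (negPf xs) andbF.
  case: s {us} xs => //= _; apply/eqP => /setP/(_ x).
  by rewrite !inE eqxx andbF.
apply/allP/allP => maxt t'; rewrite mem_permutations => pt; apply/implyP.
  move=> adm; have pxt : perm_eq (x :: t') (x :: t) by rewrite perm_cons.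
  have /maxt : x :: t' \in permutations (x :: t) by rewrite mem_permutations.
  rewrite -/(admissible C S (x :: t')).
  by rewrite (admissible_cons _ _ (orders_perm xtF pxt)) xE eqxx adm
    !step_index_cons eqxx ltnS.
have t'F := orders_perm xtF pt;
  rewrite [_ (x :: s) (x :: t)]step_index_cons eqxx.
case: t' => [|y t'] in pt t'F *; first by have := perm_size pt.
rewrite (admissible_cons _ _ t'F) step_index_cons => /andP[_ adm].
case: eqP => [xy|//]; rewrite -{}xy in pt adm *.
rewrite perm_cons in pt.
by have /implyP := maxt t' (etrans (mem_permutations _ _) pt); apply.
Qed.

Lemma max_index_exists C S s t : admissible C S t ->
  exists t', [/\ perm_eq t' t, admissible C S t'
    & all (fun u => admissible C S u ==> (step_index s u <= step_index s t')%N)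
          (permutations t')].
Proof.
move=> adm; pose A := [seq u <- permutations t | admissible C S u].
have tA : t \in A by rewrite mem_filter adm mem_permutations perm_refl.
have [u _ maxu] := @arg_maxnP _ (SeqSub tA) xpredT
  (fun u => step_index s (val u)) isT.
have := ssvalP u; rewrite mem_filter mem_permutations => /andP[admu pu].
exists (val u); split=> //; apply/allP => v; rewrite mem_permutations => pv.
apply/implyP => admv; have vA : v \in A.
  by rewrite mem_filter admv mem_permutations (perm_trans pv).
exact: (maxu (SeqSub vA)).
Qed.

End Orderings.

Section Segments.
Variable V : finType.
Implicit Types (C : {set {set V}}) (F S : {set V}) (x y : V) (s t : seq V).
Implicit Types (G : seq (seq V)) (L P : seq {set V}).

Local Notation vset s := [set z in s].
Local Notation vsets G := [seq vset s | s : seq V <- G].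

Lemma all2_orders G L : all2 (@orders V) G L = all uniq G && (L == vsets G).
Proof.
elim: G L => [|s G IH] [|F L] //=; first by rewrite andbF.
by rewrite IH eqseq_cons [F == _]eq_sym /orders andbACA.
Qed.

Lemma vset_cons_D1 x s : uniq (x :: s) -> vset (x :: s) :\ x = vset s.
Proof. by case/andP => xs _; rewrite set_cons setU1K // inE. Qed.

Lemma path_step_cons C S x s G :
  all (fun t => uniq (x :: t) &&
         (vdist C (vset (x :: t)) S == vdist C [set x] S)) (s :: G) ->
  path (monotone_conservative_step C S) (x :: s) (map (cons x) G) =
  path (monotone_conservative_step (link C x) (next_target C S x)) s G.
Proof.
elim: G s => //= t G IH s /and3P[/andP[us _] ut aG].
rewrite IH /= ?ut //; congr (_ && _).
have /andP[uxt /eqP xE] := ut.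
by apply: (@step_cons _ _ _ _ _ _ (vset (x :: t))) => //; apply/ordersP; split.
Qed.

Lemma adjacentD1 x F F' : x \in F -> x \in F' ->
  adjacent (F :\ x) (F' :\ x) = adjacent F F'.
Proof.
move=> xF xF'; have DE (A B : {set V}) : x \in B -> (A :\ x) :\: (B :\ x) = A
  :\: B.
  move=> xB; apply/setP => z; rewrite !inE; case: eqP => [->|] //=.
  by rewrite xB.
by rewrite /adjacent !DE.
Qed.

Lemma dual_path_link C x L : simplicial_complex C ->
  {in L, forall F, x \in F} -> dual_path C L ->
  dual_path (link C x) [seq F :\ x | F : {set V} <- L].
Proof.
move=> scC xL /andP[/allP fL sL]; apply/andP; split.
  by apply/allP => _ /mapP[F FL ->]; apply: link_facet (xL _ FL) => //;
    apply: fL.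
rewrite sorted_map; apply: (sub_in_sorted (P := mem L)) sL; last exact/allP.
by move=> F F' FL F'L /=; rewrite adjacentD1 ?xL.
Qed.

Lemma only_last_meetsP S F P :
  reflect (last F P :&: S != set0 /\
           {in F :: P, forall F', F' :&: S != set0 -> F' = last F P})
          (only_last_meets S F P).
Proof.
apply: (iffP eqP) => [/setP olm|[lastS olm]].
  split=> [|F' F'P F'S]; first by have := olm (last F P); rewrite !inE eqxx =>
    /andP[].
  by apply/eqP; have := olm F'; rewrite !inE -[_ || _]/(F' \in F :: P) F'P F'S.
apply/setP => F'; rewrite !inE -[_ || _]/(F' \in F :: P); apply/andP/eqP.
  by case=> F'P /olm ->.
by move=> ->; rewrite mem_last.
Qed.

Lemma vset_consP x s F : x \in F -> F :\ x = vset s ->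
  F = vset (x :: s) /\ x \notin s.
Proof.
move=> xF /setP Fs; have := Fs x; rewrite !inE eqxx /= => <-; split=> //.
by rewrite set_cons -(setD1K xF); congr (_ |: _); apply/setP.
Qed.

Lemma vsets_consP x P G : {in P, forall F, x \in F} ->
  [seq F :\ x | F : {set V} <- P] = vsets G ->
  P = vsets (map (cons x) G) /\ all (fun s => x \notin s) G.
Proof.
elim: P G => [|F P IH] [|s G] //= xP [Fs PG].
have [-> xs] := vset_consP (xP F (mem_head _ _)) Fs.
have [F' F'P|-> xG] := IH _ _ PG; first by apply: xP; rewrite inE F'P orbT.
by rewrite xs.
Qed.

Lemma comb_segment_ordering C S x L :
  comb_segment C S x L -> simplicial_complex C ->
  (forall F, L = [:: F] -> vdist C [set x] S = vdist C F S) ->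
  exists s G, [/\ L = vsets ((x :: s) :: G), all uniq ((x :: s) :: G),
    admissible C S (x :: s) & path (monotone_conservative_step C S) (x :: s) G].
Proof.
elim=> {C S x L}.
- move=> C S x F FC xF FS scC /(_ F erefl) xE.
  have [s /ordersP[us sF] adm] := admissible_exists_cons xF xE.
  by exists s, [::]; rewrite all_seq1 [vsets _]/= sF.
- move=> C S x v rC dp xS vS scC _; exists [::], [:: [:: v]].
  have set1E (z : V) : vset [:: z] = [set z] by apply/setP => w; rewrite !inE.
  have xv : x != v by apply/eqP => xv; have := in_set0 v;
    rewrite -xS !inE xv eqxx vS.
  have S0 : S != set0 by apply/set0Pn; exists v.
  have xn : [set x] != set0 by apply/set0Pn; exists x; apply: set11.
  have vE : vdist C [set v] S = Some 0%N by apply/eqP; rewrite vdist1_eq0.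
  split; rewrite /= ?set1E ?eqxx //.
  rewrite /monotone_conservative_step /conservative_step /= !set1E eqxx andbT.
  rewrite vE vdist_rank1 //= !andbT; apply/andP; split=> //.
  by apply/eqP/setP => z; rewrite !inE; case: (eqVneq z x) => [->|];
    rewrite ?xv ?andbF.
move=> C S x F P1 Fk P2 l y x1 rC dp FS olm Fl P1l Fkl yE xP _ IH1 _ IH2 scC _.
have rC1 : rank C != 1%N by rewrite neq_ltn rC orbT.
have /allP/= fC := (andP dp).1.
have xF : x \in F by apply: xP; rewrite mem_head.
have xFk : x \in Fk by apply: xP; rewrite inE mem_rcons mem_head orbT.
have FC : F \in facets C by apply: fC; rewrite mem_head.
have FkC : Fk \in facets C by apply: fC; rewrite inE mem_cat mem_head !orbT.
have /setIdP[yFk /eqP yl] : y \in [set z in Fk | vdist C [set z] S == Some l].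
  by rewrite yE set11.
have xl' : (Some l.+1 : natoo) <= vdist C [set x] S by rewrite -Fl
  vdist_le_set1.
have skelFk z : z \in Fk -> (vdist C [set z] S : natoo) < Some l.+1 -> skel C x
  z.
  move=> zFk zl; apply: (skel_facet scC FkC) => //.
  by apply: contraTneq zl => <-; rewrite -leNgt.
have xl : vdist C [set x] S = Some l.+1.
  apply/le_anti; rewrite xl' andbT; apply: vdist_skel (yl) => //.
  by apply: skelFk; rewrite // yl natoo_ltE.
have Fkl' : vdist C Fk S = Some l.
  have [|z zFk zE] := vdist_attained C S (F := Fk); first by apply/set0Pn;
    exists x.
  have [m mE ml] := natoo_lt_Some Fkl; rewrite mE; congr Some.
  apply/eqP; rewrite eqn_leq -ltnS ml /= -ltnS.
  rewrite mE in zE; have := vdist_skel rC1 (skelFk _ zFk _) zE.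
  by rewrite xl natoo_leE; apply; rewrite zE natoo_ltE.
have xy : x != y.
  by apply/eqP => xy; move: xl; rewrite xy yl => -[]/eqP; rewrite ltn_eqF.
have xC : [set x] \in C.
  by have [_ subC] := scC; apply: (subC F); rewrite ?sub1set //;
    have /facetP[] := FC.
have [||s1 [G1 [E1 u1 adm1 path1]]] := IH1; first exact: link_complex.
  by move=> F' []; case: (P1).
have [F' [Fk' _]|t [G2 [E2 u2 adm2 path2]]] := IH2 scC;
  first by rewrite -Fk' Fkl'.
have {IH1 IH2} [Gk [h GE]] : exists Gk h, G1 = rcons Gk h.
  by case/lastP: G1 E1 {u1 path1} => [[]|Gk h]; [case: (P1)|exists Gk, h].
rewrite {}GE in E1 u1 path1.
set g := x1 :: s1 in E1 u1 adm1 path1.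
have [E1x xg] := vsets_consP xP E1.
move: E1x => /= [FE]; rewrite !map_rcons => /eqP; rewrite eqseq_rcons.
move=> /andP[/eqP P1E /eqP FkE].
move: u1 xg; rewrite /= !all_rcons => /and3P[ug uh uGk] /and3P[xg xh xGk].
exists g, (map (cons x) Gk ++ (y :: t) :: G2).
have Fadm s : vset (x :: s) \in F :: P1 -> vdist C (vset (x :: s)) S = vdist C
  [set x] S.
  move=> sP; have xs : x \in vset (x :: s) by rewrite inE mem_head.
  apply/le_anti; rewrite vdist_le_set1 //= xl.
  move: sP; rewrite inE => /orP[/eqP->|/P1l]; first by rewrite Fl.
  by rewrite leNgt.
have pathx : path (monotone_conservative_step C S) (x :: g) (map (cons x) Gk).
  rewrite path_step_cons; last first.
    rewrite /= xg ug Fadm ?eqxx /=; last by rewrite -FE mem_head.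
    apply/allP => s sG; rewrite /= (allP xGk) ?(allP uGk) //=.
    by rewrite Fadm // inE P1E map_f ?orbT // map_f.
  rewrite (next_targetE scC xl).
  by move: path1; rewrite rcons_path => /andP[].
split.
- by rewrite map_cat E2 -P1E [in RHS]/= -FE.
- rewrite /= xg ug /= all_cat; apply/andP; split=> //.
  by apply/allP => _ /mapP[s sG ->]; rewrite /= (allP xGk) ?(allP uGk).
- rewrite /= -/(vset (x :: g)) Fadm ?eqxx ?(next_targetE scC xl) //.
  by rewrite -FE mem_head.
rewrite cat_path pathx /= path2 andbT last_map.
have := path1; rewrite rcons_path => /andP[_].
rewrite /monotone_conservative_step /conservative_step => /andP[_].
move=> /and3P[rem admh _].
case: E2 => Fkt _.
have yt : orders (y :: t) Fk by apply/ordersP; rewrite Fkt; move: u2 => /andP[].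
apply/and4P; split.
- by rewrite /= xl yl ltxi_cons !natoo_leE /= leqnSn ltnn.
- rewrite -Fkt FkE; have xlast : x \notin last g Gk.
    exact: (allP (introT andP (conj xg xGk) : all _ (g :: Gk))) (mem_last _ _).
  case: (last g Gk) xlast rem => // z s' xs' /eqP <-; apply/eqP/setP => w.
  by rewrite !inE; case: eqP => //= ->; move: xs'; rewrite inE => /negPf->;
    rewrite andbF.
- exact: adm2.
apply/allP => t'; rewrite mem_permutations => pt; apply/implyP => adm'.
have t'F := orders_perm yt pt; case: t' => [|z t'] in pt t'F adm' *.
  by have := perm_size pt.
move: adm'; rewrite (admissible_cons _ _ t'F) Fkl' => /andP[zl _].
have zF : z \in Fk by move: t'F; rewrite orders_cons => /andP[].
have : z \in [set y] by rewrite -yE inE zF.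
by rewrite inE => /eqP->; rewrite !step_index_cons (negPf xy).
Qed.

Lemma step_vdist C S s t : s != [::] -> t != [::] ->
  admissible C S s -> monotone_conservative_step C S s t ->
  vdist C (vset t) S <= vdist C (vset s) S.
Proof.
case: s t => [|x s] [|y t] // _ _ /= /andP[/eqP xE _] /andP[lt].
case/and3P=> _ /= /andP[/eqP yE _] _.
by move: lt; rewrite -xE -yE /= ltxi_cons => /andP[].
Qed.

Lemma meets_path_nil C S s G :
  vset s :&: S != set0 -> dual_path C (vsets (s :: G)) ->
  only_last_meets S (vset s) (vsets G) -> admissible C S s ->
  path (monotone_conservative_step C S) s G -> G = [::].
Proof.
case: G => // t G sS /andP[_ /= /andP[adj _]] /only_last_meetsP[_ olm].
move=> adm /andP[st _]; have /andP[/eqP cs /eqP ct] := adj.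
have s0 : s != [::].
  by apply/eqP => s0; move: cs; rewrite s0 -/(vset [::]) set_nil set0D cards0.
have t0 : t != [::].
  by apply/eqP => t0; move: ct; rewrite t0 -/(vset [::]) set_nil set0D cards0.
have tS : vset t :&: S != set0.
  rewrite -(vdist_eq0 C) eq_le natoo_le0x andbT.
  have /eqP <- : vdist C (vset s) S == Some 0%N by rewrite vdist_eq0.
  exact: step_vdist.
have tL : vset t = last (vset s) (vsets (t :: G)).
  by apply: olm => //; rewrite !inE eqxx orbT.
have sL : vset s = last (vset s) (vsets (t :: G)).
  by apply: olm => //; rewrite mem_head.
by move: cs; rewrite sL -tL setDv cards0.
Qed.

(* The maximal index forces the first vertex to stay as long as it still
   realizes the distance to the target. *)
Lemma step_head C S x s t : s != [::] -> uniq (x :: s) -> uniq t ->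
  monotone_conservative_step C S (x :: s) t ->
  x \in t /\ (~~ (vdist C (vset t) S < vdist C [set x] S) ->
              exists t', t = x :: t').
Proof.
move=> s0 /andP[xs us] ut /andP[_ /and3P[/= /eqP rem adm /allP maxt]].
have xt : x \in t.
  apply: contraT => xt; case: s => // z s in s0 xs us rem maxt *.
  have : x \in [set last x (z :: s)] by rewrite -rem !inE eqxx xt.
  by rewrite inE /= => /eqP xl; have := mem_last z s; rewrite -xl (negPf xs).
split=> //; rewrite -leNgt => xle.
have xt' : x \in vset t by rewrite inE.
have xE : vdist C [set x] S = vdist C (vset t) S.
  by apply/le_anti; rewrite xle vdist_le_set1.
have [u uF admu] := admissible_exists_cons xt' xE.
have tF : orders t (vset t) by apply/ordersP; split.
have /maxt/implyP/(_ admu) : x :: u \in permutations t.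
  by rewrite mem_permutations; apply: orders_perm_eq uF tF.
case: t xt {ut rem adm maxt xt' xE xle uF tF} => // y t _.
by rewrite !step_index_cons eqxx; case: eqP => [<-|]; [exists t|].
Qed.

Lemma path_head C S x s G : s != [::] ->
  all (fun t => uniq t && (size t == (size s).+1)) ((x :: s) :: G) ->
  path (monotone_conservative_step C S) (x :: s) G ->
  {in G, forall t, ~~ (vdist C (vset t) S < vdist C [set x] S)} ->
  exists G', G = map (cons x) G'.
Proof.
move=> s0; have: (0 < size s)%N by case: (s) s0.
move: (size s) => n n0; move: s0.
elim: G s => [|t G IH] s s0; first by exists [::].
move=> /= /and3P[/andP[us sn] /andP[ut tn] aG] /andP[st pG] dG.
have [|t' tE] := (step_head s0 us ut st).2; first by apply: dG;
  rewrite mem_head.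
rewrite {}tE in ut tn st pG *.
have t'0 : t' != [::] by move: tn n0; case: (t') => //= /eqP[<-].
have [||G' ->] := IH t' t'0 _ pG.
- by move: ut tn => /= -> ->.
- by move=> u uG; apply: dG; rewrite inE uG orbT.
by exists (t' :: G').
Qed.

Lemma dual_path_cat2 C L1 L2 : dual_path C (L1 ++ L2) -> dual_path C L2.
Proof.
by rewrite /dual_path all_cat => /andP[/andP[_ ->] /cat_sorted2[]].
Qed.

Lemma dual_path_cat1 C L1 L2 : dual_path C (L1 ++ L2) -> dual_path C L1.
Proof.
by rewrite /dual_path all_cat => /andP[/andP[-> _] /cat_sorted2[]].
Qed.

Lemma only_last_meets_cat2 S F P1 F' P2 :
  only_last_meets S F (P1 ++ F' :: P2) -> only_last_meets S F' P2.
Proof.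
move/only_last_meetsP; rewrite last_cat /= => -[lS olm].
apply/only_last_meetsP; split=> // K KP; apply: olm.
by rewrite inE mem_cat KP !orbT.
Qed.

Lemma ordering_comb_segment d C S s G :
  simplicial_complex C -> pure d C -> all uniq (s :: G) ->
  dual_path C (vsets (s :: G)) -> only_last_meets S (vset s) (vsets G) ->
  admissible C S s -> path (monotone_conservative_step C S) s G ->
  exists x s', s = x :: s' /\ comb_segment C S x (vsets (s :: G)).
Proof.
elim: d C S s G => [|d IHd] C S s G scC pC.
  move=> _ /andP[/allP fC _] /only_last_meetsP[/set0Pn[z]].
  have /fC/pC/cards0_eq-> : last (vset s) (vsets G) \in vsets (s :: G).
    exact: mem_last.
  by rewrite set0I inE.
move: {2}(size G).+1 (ltnSn (size G)) => n; elim: n s G => // n IHn s G.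
rewrite ltnS => Gn uG dp olm adm pG.
have rC := pure_rank scC pC.
have fC t : t \in s :: G -> vset t \in facets C.
  by move=> tG; apply: (allP (andP dp).1); apply: map_f.
have sz t : t \in s :: G -> size t = d.+1.
  by move=> tG; rewrite -(pC _ (fC _ tG)) cardsE;
    apply/esym/card_uniqP/(allP uG).
have sizes := sz s (mem_head _ _).
case: s => [//|x s] in sizes uG dp olm adm pG fC sz *.
exists x, s; split=> //.
have xF : x \in vset (x :: s) by rewrite inE mem_head.
have FC := fC _ (mem_head _ _).
have xE : vdist C [set x] S = vdist C (vset (x :: s)) S by case/andP: adm =>
  /eqP.
have [FS|FS] := eqVneq (vset (x :: s) :&: S) set0; last first.
  have GE := meets_path_nil FS dp olm adm pG; rewrite GE.
  exact: comb_segment_meet.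
have S0 : S != set0.
  have /only_last_meetsP[/set0Pn[z zS] _] := olm; apply/set0Pn.
  by exists z; move: zS; rewrite inE => /andP[].
have [G0|G0] := eqVneq G [::].
  by move: olm => /only_last_meetsP[]; rewrite G0 FS eqxx.
have [d0|d0] := posnP d.
  rewrite {d}d0 in rC sz sizes {IHd pC}; case: s sizes =>
    // _ in uG dp olm adm pG fC sz xF FC xE FS *.
  case: G => // t G in G0 Gn uG dp olm adm pG fC sz *.
  have : size t = 1%N by apply: sz; rewrite inE mem_head orbT.
  case: t => // v [] // in uG dp olm adm pG fC sz Gn G0 * => _.
  have set1E (z : V) : vset [:: z] = [set z] by apply/setP => w; rewrite !inE.
  have /andP[/andP[vx admv] pG'] := pG.
  have vS : v \in S.
    have x1 : vdist C [set x] S = Some 1%N.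
      by rewrite xE; apply: vdist_rank1 => //; apply/set0Pn; exists x.
    move: vx; rewrite /= x1 ltxi_cons implybF -lt_leAnge =>
      /natoo_lt_Some[[|//] v0 _].
    by rewrite -(vdist1_eq0 C) v0.
  have GE : G = [::].
    apply: (@meets_path_nil C S [:: v]) => //.
    - by apply/set0Pn; exists v; rewrite set1E inE set11.
    - exact: (@dual_path_cat2 _ [:: vset [:: x]] _ dp).
    - exact: (@only_last_meets_cat2 _ _ [::] _ _ olm).
    - by case/and3P: admv.
  move: dp FS; rewrite GE /= !set1E => dp FS.
  exact: comb_segment_dim0.
have s0 : s != [::] by rewrite -size_eq0; move: sizes => [->]; rewrite -lt0n.
have rC1 : rank C != 1%N by rewrite rC eqSS -lt0n.
pose near t := vdist C (vset t) S < vdist C [set x] S.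
have [G1 [t [G2 [GE nt nG1]]]] : exists G1 t G2,
    [/\ G = G1 ++ t :: G2, near t & {in G1, forall u, ~~ near u}].
  have hasG : has near G.
    have /only_last_meetsP[lS _] := olm; apply/hasP; exists (last (x :: s) G).
      by case: (G) G0 => // u G'; rewrite /= mem_last.
    have lE : last (vset (x :: s)) (vsets G) = vset (last (x :: s) G).
      exact: (last_map (fun u : seq V => vset u)).
    rewrite lE -(vdist_eq0 C) in lS; rewrite /near (eqP lS).
    rewrite lt_def natoo_le0x andbT vdist1_eq0.
    by apply: contra_eqN FS => xS; apply/set0Pn; exists x; rewrite inE xF.
  case: (split_find hasG) => u G1 G2 nu /hasPn nG1.
  by exists G1, u, G2; rewrite cat_rcons.
subst G.
have [pG1 stept pG2] : [/\ path (monotone_conservative_step C S) (x :: s) G1,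
    monotone_conservative_step C S (last (x :: s) G1) t
    & path (monotone_conservative_step C S) t G2].
  by move: pG; rewrite cat_path /= => /and3P[].
have [Gk GkE] : exists Gk, G1 = map (cons x) Gk.
  apply: path_head s0 _ pG1 nG1; apply/allP => u uG1.
  have uG' : u \in (x :: s) :: G1 ++ t :: G2.
    by move: uG1; rewrite -cat_cons mem_cat => ->.
  by rewrite (allP uG) // (sz _ uG') -sizes eqxx.
subst G1; rewrite last_map in stept; set h := last s Gk in stept.
have kG u : u \in s :: Gk -> x :: u \in (x :: s) :: map (cons x) Gk ++ t :: G2.
  move=> uG'; rewrite -cat_cons mem_cat -[_ :: map _ _]/(map (cons x) (s ::
    Gk)).
  by rewrite map_f.
have hG : h \in s :: Gk by apply: mem_last.
have tG : t \in (x :: s) :: map (cons x) Gk ++ t :: G2.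
  by rewrite -cat_cons mem_cat mem_head orbT.
have h0 : h != [::] by have := sz _ (kG _ hG); case: (h) => //= -[d1];
  rewrite -d1 in d0.
have ut := allP uG _ tG.
have FkC := fC _ tG.
have xt : x \in t by have [] := step_head h0 (allP uG _ (kG _ hG)) ut stept.
have xFk : x \in vset t by rewrite inE.
have admt : admissible C S t by case/and4P: stept.
have [y [t0 tE]] : exists y t0, t = y :: t0 by case: (t) xt => // y t0;
  exists y, t0.
have yFk : y \in vset t by rewrite inE tE mem_head.
have yE : vdist C [set y] S = vdist C (vset t) S.
  by move: admt; rewrite tE => /andP[/eqP].
have xy : x != y by apply: contraTneq nt => xy; rewrite /near xy yE ltxx.
have [l yl xl] : exists2 l,
  vdist C [set y] S = Some l & vdist C [set x] S = Some l.+1.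
  move: nt; rewrite /near -yE.
  case yv: (vdist C [set y] S) => [l|]; last by rewrite ltNge natoo_le_None.
  move=> lt_l; exists l => //.
  have := vdist_skel rC1 (skel_facet scC FkC xFk yFk xy) yv.
  case: (vdist C [set x] S) lt_l => // m; rewrite natoo_ltE natoo_leE /= =>
    lm ml.
  by congr Some; apply/eqP; rewrite eqn_leq ml lm.
have near_k u : u \in s :: Gk -> vdist C (vset (x :: u)) S = Some l.+1.
  rewrite -xl inE => /predU1P[->|uG']; first by rewrite -xE.
  have xu : x \in vset (x :: u) by rewrite inE mem_head.
  apply/le_anti; rewrite vdist_le_set1 //= leNgt.
  by apply: nG1; apply: map_f.
have far_k u z : u \in s :: Gk -> z \in u -> vdist C [set z] S <> Some l.
  move=> uG' zu zl; have zF : z \in vset (x :: u) by rewrite !inE zu orbT.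
  by have := vdist_le_set1 C S zF; rewrite zl near_k // natoo_leE /= ltnn.
have yuniq : [set z in vset t | vdist C [set z] S == Some l] = [set y].
  have adj : adjacent (vset (x :: h)) (vset t).
    move: dp => /andP[_]; rewrite /= map_cat cat_path /= => /and3P[_].
    by rewrite last_map last_map.
  have /andP[_ /cards1P[w wE]] := adj.
  have new z : z \in vset t -> vdist C [set z] S = Some l -> z = w.
    move=> zt zl; apply/set1P; rewrite -wE inE zt andbT !inE negb_or.
    apply/andP; split; first by apply/eqP => zx; move: xl; rewrite -zx zl =>
      -[]/eqP; rewrite ltn_eqF.
    by apply/negP => /(far_k _ _ hG).
  apply/setP => z; rewrite !inE; apply/andP/eqP => [[zt /eqP zl]|->].
    by rewrite (new y) // (new z) // inE.
  by rewrite yl eqxx tE mem_head.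
set S' := [set w | skel C x w && (vdist C [set w] S == Some l)].
have S'E : next_target C S x = S' by apply: next_targetE.
have yS' : y \in S' by rewrite inE yl eqxx (skel_facet scC FkC).
have [t1 [t1F adm1 max1]] : exists t1, [/\ orders t1 (vset t :\ x),
    admissible (link C x) S' t1 &
    all (fun u => admissible (link C x) S' u ==>
      (step_index h u <= step_index h t1)%N) (permutations t1)].
  have [u uF admu] := admissible_exists (link C x) S' (vset t :\ x).
  have [t1 [pt1 adm1 max1]] := max_index_exists h admu.
  by exists t1; split=> //; apply: orders_perm uF pt1.
have [ut1 t1E] := ordersP _ _ t1F.
have t1S : vset t1 :&: S' != set0.
  by apply/set0Pn; exists y; rewrite in_setI yS' andbT t1E in_setD1 eq_sym xy.
have kS u : u \in s :: Gk -> vset u :&: S' = set0.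
  move=> uG'; apply/setP => z; rewrite !inE; apply/negP => /and3P[zu _ /eqP zl].
  exact: far_k uG' zu zl.
have uniqk u : u \in s :: Gk -> uniq (x :: u) by move/kG/(allP uG).
have linkE : [seq F :\ x | F : {set V} <- rcons (vsets ((x :: s) :: map (cons
  x) Gk)) (vset t)]
    = vsets (s :: rcons Gk t1).
  rewrite map_rcons -rcons_cons map_rcons t1E; congr rcons.
  rewrite -[(x :: s) :: _]/(map (cons x) (s :: Gk)) -!map_comp.
  by apply/eq_in_map => u uG' /=; apply/vset_cons_D1/uniqk.
have xP : {in rcons (vsets ((x :: s) :: map (cons x) Gk)) (vset t),
    forall F : {set V}, x \in F}.
  move=> F; rewrite mem_rcons inE => /predU1P[-> //|].
  rewrite -[(x :: s) :: _]/(map (cons x) (s :: Gk)) -map_comp => /mapP[u _ ->].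
  by rewrite inE mem_head.
have xC : [set x] \in C.
  by have [_ subC] := scC; have /facetP[FinC _] := FC; apply: subC FinC _;
    rewrite sub1set.
have [x1 [s1 [_ seg1]]] : exists x1 s1, s = x1 :: s1 /\
    comb_segment (link C x) S' x1 (vsets (s :: rcons Gk t1)).
  apply: IHd.
  - exact: link_complex.
  - exact: link_pure.
  - rewrite -rcons_cons all_rcons ut1; apply/allP => u /uniqk.
    by case/andP.
  - rewrite -linkE; apply: dual_path_link => //.
    by move: dp; rewrite -cat_cons -cat_rcons map_cat map_rcons =>
      /dual_path_cat1.
  - apply/only_last_meetsP; rewrite map_rcons last_rcons; split=> // F.
    rewrite -rcons_cons mem_rcons inE => /predU1P[-> //|].
    by rewrite -[_ :: _]/(vsets (s :: Gk)) => /mapP[u /kS uS ->];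
      rewrite uS eqxx.
  - by case/andP: adm; rewrite S'E.
  rewrite rcons_path -/h; apply/andP; split.
    rewrite -S'E -path_step_cons //; apply/allP => u uG'.
    by rewrite uniqk //= -/(vset (x :: u)) near_k ?xl.
  case/and4P: stept => _ rem _ _; apply/and4P; split=> //.
    have [a [h1 hE]] : exists a h1, h = a :: h1 by case: (h) h0 => // a h1;
      exists a, h1.
    have [b [t2 t1b]] : exists b t2, t1 = b :: t2.
      case: (t1) t1S => [|b t2]; last by exists b, t2.
      by rewrite set_nil set0I eqxx.
    have /andP[/eqP bE _] : admissible (link C x) S' (b :: t2) by rewrite -t1b.
    have b0 : vdist (link C x) [set b] S' = Some 0%N.
      by rewrite bE -t1b; apply/eqP; rewrite vdist_eq0.
    have aS : a \notin S'.
      apply/negP => aS; have := in_set0 a; rewrite -(kS _ hG) in_setI aS andbT.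
      by rewrite hE inE mem_head.
    rewrite -(vdist1_eq0 (link C x)) in aS.
    rewrite hE t1b /= b0 ltxi_cons natoo_le0x /=.
    apply/implyP => a0; case/eqP: aS; apply/le_anti.
    by rewrite a0 natoo_le0x.
  case: (h) h0 (uniqk _ hG) rem => // a h1 _ xah /eqP rem; rewrite t1E.
  rewrite -(vset_cons_D1 xah); apply/eqP;
    rewrite -[last a h1]/(last x (a :: h1)) -rem.
  apply/setP => z; rewrite !inE; case: eqP => [->|] //=.
  by rewrite xt.
have [y' [t2 [t2E seg2]]] : exists y t',
  t = y :: t' /\ comb_segment C S y (vsets (t :: G2)).
  apply: IHn => //.
  - by apply: leq_trans Gn; rewrite size_cat /= addnS ltnS leq_addl.
  - by move: uG; rewrite -cat_cons all_cat => /andP[].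
  - by move: dp; rewrite -cat_cons map_cat => /dual_path_cat2.
  - by move: olm; rewrite map_cat => /only_last_meets_cat2.
have yy : y = y' by move: t2E; rewrite tE => -[].
rewrite -yy in seg2.
rewrite /= map_cat; apply: (comb_segment_rec (Fk := vset t) (P2 := vsets G2) (l
  := l) (y := y) (x1 := x1)).
- by rewrite rC.
- by move: dp; rewrite /= map_cat.
- by [].
- by move: olm; rewrite map_cat.
- by rewrite -xE.
- move=> _ /mapP[u uG1 ->]; rewrite -xl; exact: nG1.
- by rewrite -xl.
- exact: yuniq.
- exact: xP.
- by rewrite -/S'; move: seg1; rewrite -linkE.
exact: seg2.
Qed.

End Segments.

Theorem theorem2p13 (V : finType) (d : nat) (C : {set {set V}}) (S : {set V})
    (F0 : {set V}) (P : seq {set V}) :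
  simplicial_complex C -> pure d C -> normal C ->
  S \subset vertices C -> S != set0 ->
  dual_path C (F0 :: P) -> only_last_meets S F0 P ->
  (exists2 x0 : V, x0 \in F0 & comb_segment C S x0 (F0 :: P)) <->
  (exists2 G : seq (seq V), all2 (@orders V) G (F0 :: P) &
     monotone C S G /\ conservative C S G).
Proof.
move=> scC pC _ _ _ dp olm; split.
  case=> x0 x0F seg.
  have [x xseg xE] : exists2 x, comb_segment C S x (F0 :: P) &
      forall F, F0 :: P = [:: F] -> vdist C [set x] S = vdist C F S.
    case: P dp olm seg => [|F P] dp olm seg; last by exists x0.
    have /only_last_meetsP[/= FS _] := olm.
    have /set0Pn[x] := FS; rewrite inE => /andP[xF xS].
    have FC : F0 \in facets C by move: dp; rewrite /dual_path /= !andbT.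
    exists x => [|_ [<-]]; first exact: comb_segment_meet.
    have /eqP-> : vdist C [set x] S == Some 0%N by rewrite vdist1_eq0.
    by apply/esym/eqP; rewrite vdist_eq0.
  have [s [G [LE uG adm pG]]] := comb_segment_ordering xseg scC xE.
  exists ((x :: s) :: G); first by rewrite all2_orders uG LE eqxx.
  by apply/andP; rewrite monotone_conservativeE adm pG.
case=> -[|s G] //; rewrite all2_orders => /andP[uG /eqP[FE PE]] /andP.
rewrite monotone_conservativeE => /andP[adm pG].
rewrite {}FE {}PE in dp olm *.
have [x [s' [sE seg]]] := ordering_comb_segment scC pC uG dp olm adm pG.
by exists x => //; rewrite inE sE mem_head.
Qed.
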